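(* Let $\mu$ be a Borel probability measure on $\mathbb{R}$ with quantile function $Q_\mu:(0,1)\to\mathbb{R}$. The following are equivalent: (0) $\mu$ is c.d.f.-unimodal; (a) there exists a quantile density $q_\mu:(0,1)\to[0,+\infty]$ of $\mu$ which is quasi-convex (in particular, $Q_\mu$ is absolutely continuous); (b) there exists $\alpha\in[0,1]$ (a quantile mode) such that $Q_\mu$ is concave on $(0,\alpha]\cap(0,1)$ and convex on $[\alpha,1)\cap(0,1)$.
   Context: $\lambda$ denotes Lebesgue measure. For a probability measure $\mu$ on $(\mathbb{R},\mathcal{B}(\mathbb{R}))$, the cumulative distribution function is $F_\mu(x)=\mu((-\infty,x])$, $x\in\mathbb{R}$, and the quantile function is $Q_\mu(t)=\inf\{x\in\mathbb{R} : t\le F_\mu(x)\}$, $t\in(0,1)$. The measure $\mu$ is called c.d.f.-unimodal if there exists $\nu\in\mathbb{R}$ such that $F_\mu$ is convex on $(-\infty,\nu]$ and concave on $[\nu,+\infty)$. The function $Q_\mu$ is absolutely continuous if there is a measurable $q_\mu:(0,1)\to[0,+\infty]$ with $Q_\mu(y)-Q_\mu(x)=\int_x^y q_\mu\,\mathrm{d}\lambda$ for all $x,y\in(0,1)$; any such $q_\mu$ is called a quantile density of $\mu$. A function $f:I\to[-\infty,+\infty]$ on an open interval $I$ is quasi-convex if $f(wx+(1-w)y)\le\max(f(x),f(y))$ for all $x,y\in I$ and $w\in(0,1)$. Concavity or convexity on an empty set is vacuously true. *)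

(* Defs.v *)
From HB Require Import structures.
From mathcomp Require Import all_boot all_order all_algebra.
From mathcomp Require Import all_classical all_reals all_analysis.
From mathcomp Require Import measurable_realfun.

Set Implicit Arguments.
Unset Strict Implicit.
Unset Printing Implicit Defensive.

Import Order.TTheory GRing.Theory Num.Theory.
Import numFieldNormedType.Exports.

Local Open Scope classical_set_scope.
Local Open Scope ring_scope.

Definition concave_function (R : realType) (D : set R) (f : R -> R) : Prop :=
  convex_function D (\- f).

(* A function on a set D is represented by a total function on R whose values
   outside D are irrelevant. *)
Definition quasi_convex (R : realType) (D : set R) (f : R -> \bar R) : Prop :=
  forall x y w : R, D x -> D y -> 0 < w < 1 ->
    (f (w * x + (1 - w) * y)%R <= Order.max (f x) (f y))%E.

(* \int_a^b f with the usual sign convention when b < a *)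
Definition oriented_integral (R : realType) (f : R -> \bar R) (a b : R) :
    \bar R :=
  if a <= b then (\int[@lebesgue_measure R]_(t in `[a, b]) f t)%E
  else (- \int[@lebesgue_measure R]_(t in `[b, a]) f t)%E.

Section QuantileUnimodality.
Variables (R : realType) (mu : probability (measurableTypeR R) R).

(* The library's cdf is that of a random variable; this is the cdf of a
   probability measure on R, real-valued since mu is finite. *)
Definition distr_fun (x : R) : R := fine (mu `]-oo, x]%classic).

(* For t in ]0, 1[ the set is nonempty and bounded below, so that inf is its
   greatest lower bound; the values of quantile outside ]0, 1[ are not used. *)
Definition quantile (t : R) : R := inf [set x : R | t <= distr_fun x].

Definition cdf_unimodal : Prop :=
  exists nu : R, convex_function (`]-oo, nu] : set R) distr_fun /\
                 concave_function `[nu, +oo[ distr_fun.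

Definition quantile_density (q : R -> \bar R) : Prop :=
  [/\ measurable_fun (`]0, 1[ : set R) q,
      forall t, 0 < t < 1 -> (0 <= q t)%E &
      forall x y, 0 < x < 1 -> 0 < y < 1 ->
        (quantile y - quantile x)%:E = oriented_integral q x y].

Definition quantile_mode (alpha : R) : Prop :=
  0 <= alpha <= 1 /\
  (concave_function (`]0, alpha] `&` `]0, 1[) quantile /\
   convex_function (`[alpha, 1[ `&` `]0, 1[ : set R) quantile).

End QuantileUnimodality.

(* Main.v *)
Require Import Defs.
From HB Require Import structures.
From mathcomp Require Import all_boot all_order all_algebra.
From mathcomp Require Import all_classical all_reals all_analysis.
From mathcomp Require Import measurable_realfun ring lra.

(* On (0, 1) the quantile function satisfies Q t <= x <-> t <= F x, so convexity
   of F on a half-line turns into concavity of Q on the corresponding levels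
   and conversely; this gives (0) <-> (b).
   For (b) -> (a), let q be the left derivative of Q up to alpha and the right
   derivative after alpha. It is quasi-convex, and it is a density because on
   each side both Q y - Q x and the integral of q over [x, y] lie between the
   endpoint values of q times y - x: cutting [x, y] into many equal pieces shows
   that they agree.
   For (a) -> (b), a quasi-convex q is nonincreasing up to some alpha and
   nondecreasing after it; comparing its integrals over [x, y] and [y, z] with
   q y gives the slope inequalities of Q. *)

Set Implicit Arguments.
Unset Strict Implicit.
Unset Printing Implicit Defensive.

Import Order.TTheory GRing.Theory Num.Theory.
Import numFieldNormedType.Exports.

Local Open Scope classical_set_scope.
Local Open Scope ring_scope.

(** * Convexity and concavity through weights and through slopes *)

Section ConvexFunctions.
Variable R : realType.
Implicit Types (D : set R) (f : R -> R).

Lemma convex_functionP D f :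
  convex_function D f <->
  forall x y w : R, D x -> D y -> 0 < w < 1 ->
    f (w * x + (1 - w) * y) <= w * f x + (1 - w) * f y.
Proof.
split=> [cf x y w Dx Dy /andP[w0 w1]|cf t x y].
  have := cf (Itv01 (ltW w0) (ltW w1)) x y.
  by rewrite !inE => /(_ Dx Dy).
rewrite !inE => Dx Dy.
have [t0|t0] := eqVneq t%:num 0.
  have -> : t = 0%:i01 by apply/val_inj.
  by rewrite !conv0.
have [t1|t1] := eqVneq t%:num 1.
  have -> : t = 1%:i01 by apply/val_inj.
  by rewrite !conv1.
have tP : 0 < t%:num < 1.
  rewrite !lt_neqAle t1 eq_sym t0 /=.
  by have : 0 <= t%:num <= 1 by rewrite ge0 le1.
exact: cf.
Qed.

(** Exchanging [x] and [y] replaces [w] by [1 - w], and for [x = y] both sides agree. *)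
Lemma convex_function_ordered D f :
  (forall x y w : R, D x -> D y -> x < y -> 0 < w < 1 ->
    f (w * x + (1 - w) * y) <= w * f x + (1 - w) * f y) ->
  convex_function D f.
Proof.
move=> cf; apply/convex_functionP => x y w Dx Dy w01.
have [xy|xy|->] := ltgtP x y.
- exact: cf.
- have := cf y x (1 - w) Dy Dx xy.
  rewrite subKr (addrC (_ * y)) (addrC (_ * f y)); apply.
  by rewrite subr_gt0 ltrBlDr ltrDl andbC.
- by rewrite -!mulrDl subrKC !mul1r.
Qed.

Lemma concave_functionP D f :
  concave_function D f <->
  forall x y w : R, D x -> D y -> 0 < w < 1 ->
    w * f x + (1 - w) * f y <= f (w * x + (1 - w) * y).
Proof.
apply: (iff_trans (convex_functionP _ _)).
by split=> cf x y w Dx Dy /(cf x y w Dx Dy) /=; lra.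
Qed.

Lemma concave_function_ordered D f :
  (forall x y w : R, D x -> D y -> x < y -> 0 < w < 1 ->
    w * f x + (1 - w) * f y <= f (w * x + (1 - w) * y)) ->
  concave_function D f.
Proof.
move=> cf; apply: convex_function_ordered => x y w Dx Dy xy.
by move=> /(cf x y w Dx Dy xy) /=; lra.
Qed.

(** The slopes over [[x, y]] and [[y, z]] are compared after cross-multiplication; [y] is the
    combination of [x] and [z] with weight [(z - y) / (z - x)] at [x]. *)
Lemma convex_function_slopeP D f :
  convex_function D f <->
  forall x y z : R, D x -> D z -> x < y < z ->
    (f y - f x) * (z - y) <= (f z - f y) * (y - x).
Proof.
split=> [/convex_functionP cf x y z Dx Dz /andP[xy yz]|sf].
  have xz : 0 < z - x by lra.
  pose w := (z - y) / (z - x).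
  have w01 : 0 < w < 1 by rewrite divr_gt0 ?ltr_pdivrMr; lra.
  have := cf x z w Dx Dz w01.
  have -> : w * x + (1 - w) * z = y by rewrite /w; field; lra.
  rewrite -(ler_pM2r xz).
  have -> : (w * f x + (1 - w) * f z) * (z - x) = (z - y) * f x + (y - x) * f z.
    by rewrite /w; field; lra.
  lra.
apply: convex_function_ordered => x z w Dx Dz xz /andP[w0 w1].
set y := w * x + (1 - w) * z.
have yx : y - x = (1 - w) * (z - x) by rewrite /y; ring.
have zy : z - y = w * (z - x) by rewrite /y; ring.
have xyz : x < y < z by rewrite -subr_gt0 -(subr_gt0 y) yx zy !mulr_gt0//; lra.
have := sf x y z Dx Dz xyz; rewrite yx zy !mulrA ler_pM2r ?subr_gt0//.
lra.
Qed.

Lemma concave_function_slopeP D f :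
  concave_function D f <->
  forall x y z : R, D x -> D z -> x < y < z ->
    (f z - f y) * (y - x) <= (f y - f x) * (z - y).
Proof.
apply: (iff_trans (convex_function_slopeP _ _)).
by split=> cf x y z Dx Dz /(cf x y z Dx Dz) /=; lra.
Qed.

End ConvexFunctions.

(** * The distribution function and its Galois connection with the quantile function *)

Section DistributionFunction.
Variables (R : realType) (mu : probability (measurableTypeR R) R).
Local Notation F := (distr_fun mu).
Local Notation Q := (quantile mu).

(** Under [mu] the identity is a random variable of law [mu], so the general facts on [cdf] carry
    over to [F]. *)
Let idTR : measurableTypeR R -> R := idfun.

#[local] HB.instance Definition _ :=
  @isMeasurableFun.Build _ _ _ _ idTR (@measurable_id _ _ setT).

Let cdfE x : cdf (idTR : {RV mu >-> R}) x = (F x)%:E.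
Proof. by rewrite fineK// fin_num_measure. Qed.

Lemma distr_fun_ge0 x : 0 <= F x.
Proof. by rewrite -lee_fin -cdfE cdf_ge0. Qed.

Lemma distr_fun_le1 x : F x <= 1.
Proof. by rewrite -lee_fin -cdfE cdf_le1. Qed.

Lemma distr_fun_nondecreasing x y : x <= y -> F x <= F y.
Proof. by move=> xy; rewrite -lee_fin -!cdfE cdf_nondecreasing. Qed.

Lemma distr_fun_lt_inv x y : F x < F y -> x < y.
Proof.
move=> Fxy; rewrite ltNge; apply: contraTN Fxy => /distr_fun_nondecreasing.
by rewrite -leNgt.
Qed.

Lemma distr_fun_small t : 0 < t -> exists x, F x < t.
Proof.
move=> t0; apply: contrapT => /forallNP Ft.
suff : (t%:E <= 0)%E by rewrite lee_fin leNgt t0.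
apply: (cvge_to_ge (cvg_cdfNy0 (idTR : {RV mu >-> R}))); apply: nearW => x.
by rewrite cdfE lee_fin leNgt; apply/negP/Ft.
Qed.

Lemma distr_fun_large t : t < 1 -> exists x, t < F x.
Proof.
move=> t1; apply: contrapT => /forallNP Ft.
suff : (1 <= t%:E)%E by rewrite lee_fin leNgt t1.
apply: (cvge_to_le (cvg_cdfy1 (idTR : {RV mu >-> R}))); apply: nearW => x.
by rewrite cdfE lee_fin leNgt; apply/negP/Ft.
Qed.

Lemma distr_fun_right_continuous x c :
  (forall y, x < y -> c <= F y) -> c <= F x.
Proof.
move=> cF; rewrite -lee_fin -cdfE.
have Frc := @cdf_right_continuous _ _ _ _ (idTR : {RV mu >-> R}) x.
apply: (cvge_to_ge Frc); near=> y.
rewrite cdfE lee_fin; apply: cF.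
by near: y; exact: nbhs_right_gt.
Unshelve. all: by end_near.
Qed.

(** From right to left, the infimum is a lower bound. From left to right, every [y > x] lies above
    some [z] with [t <= F z], and right continuity of [F] gives [t <= F x]. *)
Lemma quantile_le t x : 0 < t < 1 -> (Q t <= x) = (t <= F x).
Proof.
move=> /andP[t0 t1].
have [l Fl] := distr_fun_small t0; have [u Fu] := distr_fun_large t1.
have lb : lbound [set x | t <= F x] l.
  move=> y /= tFy; apply/ltW/distr_fun_lt_inv; exact: lt_le_trans tFy.
have hi : has_inf [set x | t <= F x].
  by split; [exists u; exact: ltW | exists l].
apply/idP/idP => [Qx|tFx].
  apply: distr_fun_right_continuous => y xy.
  have [z /= tz zy] : exists2 z, t <= F z & z < y.
    have yQ : 0 < y - Q t by lra.
    have [z tz] := inf_adherent yQ hi.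
    rewrite -/(Q t) => zy; exists z => //; lra.
  exact: le_trans tz (distr_fun_nondecreasing (ltW zy)).
by apply: ge_inf => //; case: hi.
Qed.

Lemma quantile_gt t x : 0 < t < 1 -> (x < Q t) = (F x < t).
Proof. by move=> t01; rewrite !ltNge quantile_le. Qed.

Lemma le_distr_fun_quantile t : 0 < t < 1 -> t <= F (Q t).
Proof. by move=> t01; rewrite -quantile_le. Qed.

Lemma quantile_nondecreasing s t :
  0 < s < 1 -> 0 < t < 1 -> s <= t -> Q s <= Q t.
Proof.
move=> s01 t01 st; rewrite quantile_le// (le_trans st)//.
exact: le_distr_fun_quantile.
Qed.

End DistributionFunction.

(** * From a unimodal c.d.f. to a quantile mode *)

Section CdfToQuantile.
Variables (R : realType) (mu : probability (measurableTypeR R) R).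
Local Notation F := (distr_fun mu).
Local Notation Q := (quantile mu).

(** Some [y] has [F y < F nu]; if [F x = F nu], then [y < x < nu] and convexity would put [F x]
    strictly below [F nu]. *)
Lemma convex_distr_fun_lt (nu x : R) :
  convex_function (`]-oo, nu] : set R) F -> 0 < F nu -> x < nu -> F x < F nu.
Proof.
move=> /convex_functionP cF Fnu xnu.
rewrite lt_neqAle distr_fun_nondecreasing ?ltW// andbT.
apply/eqP => Fx; have [y Fy] := distr_fun_small mu Fnu.
have yx : y < x by apply: (@distr_fun_lt_inv _ mu); rewrite Fx.
pose w := (nu - x) / (nu - y).
have w0 : 0 < w by rewrite divr_gt0; lra.
have w1 : w < 1 by rewrite ltr_pdivrMr; lra.
have xE : w * y + (1 - w) * nu = x by rewrite /w; field; lra.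
have := cF y nu w; rewrite xE Fx !set_itvE /= => cFy.
have {}cFy : F nu <= w * F y + (1 - w) * F nu by apply: cFy; lra.
have : w * (F nu - F y) > 0 by rewrite mulr_gt0; lra.
lra.
Qed.

Lemma quantile_concave (nu : R) : convex_function (`]-oo, nu] : set R) F ->
  concave_function (`]0, F nu] `&` `]0, 1[) Q.
Proof.
move=> /convex_functionP cF; apply/concave_functionP => s t w.
rewrite !set_itvE /= => -[/andP[_ sF] s01] [/andP[_ tF] t01] /andP[w0 w1].
have r01 : 0 < w * s + (1 - w) * t < 1 by apply/andP; split; nra.
rewrite leNgt; apply/negP => Qlt.
(* Half the supposed gap: after shifting [Q s] and [Q t] left by [d], [F] is below [s] and [t]
   there, while the combination of the shifted points still exceeds [Q] of the combined level. *)
pose d := (w * Q s + (1 - w) * Q t - Q (w * s + (1 - w) * t)) / 2.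
have d0 : 0 < d by rewrite divr_gt0; lra.
have Fs : F (Q s - d) < s by rewrite -quantile_gt//; lra.
have Ft : F (Q t - d) < t by rewrite -quantile_gt//; lra.
have snu : Q s <= nu by rewrite quantile_le.
have tnu : Q t <= nu by rewrite quantile_le.
have : F (w * (Q s - d) + (1 - w) * (Q t - d)) < w * s + (1 - w) * t.
  have -> : w * (Q s - d) + (1 - w) * (Q t - d) = w * Q s + (1 - w) * Q t - d.
    by ring.
  have : F (w * Q s + (1 - w) * Q t - d) <=
      w * F (Q s - d) + (1 - w) * F (Q t - d).
    have -> : w * Q s + (1 - w) * Q t - d = w * (Q s - d) + (1 - w) * (Q t - d).
      by ring.
    by apply: cF; rewrite ?set_itvE /=; lra.
  nra.
rewrite -quantile_gt// /d; lra.
Qed.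

Lemma quantile_convex (nu : R) : convex_function (`]-oo, nu] : set R) F ->
  concave_function `[nu, +oo[ F ->
  convex_function (`[F nu, 1[ `&` `]0, 1[ : set R) Q.
Proof.
move=> cvF /concave_functionP cF; apply/convex_functionP => s t w.
rewrite !set_itvE /= => -[/andP[Fs _] s01] [/andP[Ft _] t01] /andP[w0 w1].
have r01 : 0 < w * s + (1 - w) * t < 1 by apply/andP; split; nra.
(* Concavity of [F] is available only from [nu] on. If [Q z < nu], then [F] would take the same
   value at [Q z] and at [nu], against strict growth before [nu]. *)
have nuQ z : 0 < z < 1 -> F nu <= z -> nu <= Q z.
  move=> z01 nuz; rewrite leNgt; apply/negP => Qz.
  have zF := le_distr_fun_quantile mu z01.
  have Fnu : F (Q z) = F nu.
    apply/eqP; rewrite eq_le distr_fun_nondecreasing ?(ltW Qz)//=; lra.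
  have Fnu0 : 0 < F nu by lra.
  by have := convex_distr_fun_lt cvF Fnu0 Qz; rewrite Fnu ltxx.
have sF := le_distr_fun_quantile mu s01.
have tF := le_distr_fun_quantile mu t01.
rewrite quantile_le//.
apply: (@le_trans _ _ (w * F (Q s) + (1 - w) * F (Q t))); first nra.
by apply: cF; rewrite ?set_itvE /= ?nuQ ?w0.
Qed.

Lemma cdf_unimodal_quantile_mode :
  cdf_unimodal mu -> exists alpha, quantile_mode mu alpha.
Proof.
move=> [nu [cvF ccF]]; exists (F nu); split.
  by rewrite distr_fun_ge0 distr_fun_le1.
by split; [exact: quantile_concave | exact: quantile_convex].
Qed.

End CdfToQuantile.

(** * From a quantile mode to a unimodal c.d.f *)

Section QuantileToCdf.
Variables (R : realType) (mu : probability (measurableTypeR R) R).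
Local Notation F := (distr_fun mu).
Local Notation Q := (quantile mu).

Lemma convex_quantile_bounded_below :
  convex_function (`[0, 1[ `&` `]0, 1[ : set R) Q ->
  has_lbound [set x | 0 < F x].
Proof.
move=> /convex_functionP cQ.
(* The value at level 0 of the line through the graph of [Q] at 1/2 and 3/4; a convex [Q] stays
   above this line to the left of 1/2. *)
exists (Q (3 / 4) - 3 * (Q (3 / 4) - Q (1 / 2))) => x /= Fx.
pose t := Num.min (F x) (1 / 4).
have t0 : 0 < t by rewrite lt_min Fx; lra.
have t4 : t <= 1 / 4 by rewrite ge_min lexx orbT.
have Qtx : Q t <= x by rewrite quantile_le ?ge_min ?lexx//; lra.
pose w := (1 / 4) / (3 / 4 - t).
have w3 : 1 / 3 <= w by rewrite /w ler_pdivlMr; lra.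
have w1 : w < 1 by rewrite /w ltr_pdivrMr; lra.
have := cQ t (3 / 4) w.
have -> : w * t + (1 - w) * (3 / 4) = 1 / 2 by rewrite /w; field; lra.
rewrite !set_itvE /= => H.
have {}H : Q (1 / 2) <= w * Q t + (1 - w) * Q (3 / 4) by apply: H; lra.
have : Q t <= Q (3 / 4) by apply: quantile_nondecreasing; lra.
nra.
Qed.

Lemma concave_quantile_bounded_above :
  concave_function (`]0, 1] `&` `]0, 1[ : set R) Q ->
  has_ubound [set x | F x < 1].
Proof.
move=> /concave_functionP cQ.
(* Likewise the value at level 1 of the line through the graph at 1/4 and 1/2. Below,
   [(F x + 1) / 2] is a level strictly between [F x] and 1. *)
exists (Q (1 / 4) + 3 * (Q (1 / 2) - Q (1 / 4))) => x /= Fx.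
pose t := Num.max ((F x + 1) / 2) (3 / 4).
have t1 : t < 1 by rewrite gt_max; lra.
have t4 : 3 / 4 <= t by rewrite le_max lexx orbT.
have Qtx : x < Q t by rewrite quantile_gt ?lt_max; lra.
pose w := (1 / 4) / (t - 1 / 4).
have w3 : 1 / 3 <= w by rewrite /w ler_pdivlMr; lra.
have w1 : w < 1 by rewrite /w ltr_pdivrMr; lra.
have := cQ (1 / 4) t (1 - w).
have -> : (1 - w) * (1 / 4) + (1 - (1 - w)) * t = 1 / 2.
  by rewrite /w; field; lra.
rewrite !set_itvE /= => H.
have {}H : (1 - w) * Q (1 / 4) + (1 - (1 - w)) * Q t <= Q (1 / 2).
  by apply: H; lra.
have : Q (1 / 4) <= Q t by apply: quantile_nondecreasing; lra.
nra.
Qed.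

(** The mode is [Q alpha] for [alpha] inside (0, 1). For [alpha] equal to 0 or 1 it is the left or
    right end of the support, finite by the two preceding bounds. The conclusion supplies levels on
    the proper side of [alpha], where the shape of [Q] is known. *)
Lemma quantile_mode_center alpha : quantile_mode mu alpha ->
  exists nu,
    (forall y, y < nu -> 0 < F y ->
       exists s, [/\ 0 < s < 1, s <= alpha & F y < s]) /\
    (forall y, nu < y -> F y < 1 ->
       exists s, [/\ 0 < s < 1, alpha <= s & s <= F y]).
Proof.
move=> [/andP[a0 a1] [ccQ cvQ]].
have [a_gt0|a_le0] := ltP 0 alpha; last first.
  have {a0 a_le0}aE : alpha = 0 by lra.
  rewrite aE in ccQ cvQ *.
  have lb := convex_quantile_bounded_below cvQ.
  exists (inf [set x | 0 < F x]); split=> y ynu Fy.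
    have : inf [set x | 0 < F x] <= y by exact: ge_inf.
    lra.
  have hi : has_inf [set x | 0 < F x].
    split=> //; have [x Fx] := distr_fun_large mu (@ltr01 R).
    by exists x => /=; lra.
  have e0 : 0 < y - inf [set x | 0 < F x] by lra.
  have [x /= Fx] := inf_adherent e0 hi; rewrite subrKC => xy.
  have := distr_fun_nondecreasing mu (ltW xy).
  by exists (F y); split; lra.
have [a_lt1|a_ge1] := ltP alpha 1; last first.
  have {a1 a_ge1}aE : alpha = 1 by lra.
  rewrite aE in ccQ cvQ *.
  have ub := concave_quantile_bounded_above ccQ.
  have hs : has_sup [set x | F x < 1].
    by split=> //; have [x Fx] := distr_fun_small mu (@ltr01 R); exists x.
  exists (sup [set x | F x < 1]); split=> y ynu Fy.
    have e0 : 0 < sup [set x | F x < 1] - y by lra.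
    have [x /= Fx] := sup_adherent e0 hs; rewrite subKr => yx.
    have := distr_fun_nondecreasing mu (ltW yx).
    by exists ((F y + 1) / 2); split; lra.
  have : y <= sup [set x | F x < 1] by exact: ub_le_sup.
  lra.
have a01 : 0 < alpha < 1 by rewrite a_gt0.
exists (Q alpha); split=> y ynu Fy; exists alpha; split=> //.
  by rewrite -quantile_gt.
by rewrite -quantile_le// ltW.
Qed.

(** Each half is by contradiction: [F x] and [F y] are replaced by nearby levels on the right side
    of [alpha], the shape of [Q] is applied there, and [quantile_le] leads back to [F]. The error
    [e] is half the supposed gap, so it cannot close that gap. *)
Lemma quantile_mode_cdf_unimodal alpha :
  quantile_mode mu alpha -> cdf_unimodal mu.
Proof.
move=> am; have [nu [below above]] := quantile_mode_center am.
case: am => [/andP[a0 a1] [/concave_functionP ccQ /convex_functionP cvQ]].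
exists nu; split.
  apply: convex_function_ordered => x y w.
  rewrite !set_itvE /= => xnu ynu xy w01; case/andP: (w01) => w0 w1.
  set z := w * x + (1 - w) * y.
  have xz : x < z by rewrite /z; nra.
  have zy : z < y by rewrite /z; nra.
  rewrite leNgt; apply/negP => Flt.
  have Fx0 := distr_fun_ge0 mu x; have Fy0 := distr_fun_ge0 mu y.
  have Fz0 : 0 < F z by nra.
  pose e := (F z - (w * F x + (1 - w) * F y)) / 2.
  have e0 : 0 < e by rewrite /e; lra.
  (* [below] requires a point where [F] is positive, hence the maximum with [z]; capping the level
     at [F v + e] keeps the combined level below [F z]. *)
  have level u v : u <= v -> u < nu ->
      exists s, [/\ 0 < s < 1, s <= alpha, s <= F v + e & u < Q s].
    move=> uv unu.
    have [||s [/andP[s0 s1] sa Fs]] := below (Num.max u z).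
    - by rewrite gt_max unu; lra.
    - apply: (lt_le_trans Fz0).
      by rewrite distr_fun_nondecreasing ?le_max ?lexx ?orbT.
    have Fus : F u < s.
      by apply: le_lt_trans Fs; rewrite distr_fun_nondecreasing ?le_max ?lexx.
    have Fuv := distr_fun_nondecreasing mu uv.
    have Fu0 := distr_fun_ge0 mu u.
    exists (Num.min s (F v + e)).
    have t01 : 0 < Num.min s (F v + e) < 1 by rewrite lt_min gt_min s0 s1; lra.
    split=> //.
    - by rewrite ge_min sa.
    - by rewrite ge_min lexx orbT.
    - by rewrite quantile_gt// lt_min Fus; lra.
  have [|s [s01 sa Fs Qs]] := level x x (lexx x); first lra.
  (* [y] may equal [nu], where [below] says nothing. The slack in [x < Q s] leaves room for some
     [u < y] with [w * Q s + (1 - w) * u] still at least [z]. *)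
  pose u := Num.max z ((z - w * Q s) / (1 - w)).
  have uy : u < y by rewrite gt_max zy ltr_pdivrMr /z; nra.
  have zu : z <= w * Q s + (1 - w) * u.
    have : (z - w * Q s) / (1 - w) <= u by rewrite le_max lexx orbT.
    by rewrite ler_pdivrMr; nra.
  have [|t [t01 ta Ft Qt]] := level u y (ltW uy); first lra.
  have r01 : 0 < w * s + (1 - w) * t < 1 by apply/andP; split; nra.
  have : w * Q s + (1 - w) * Q t <= Q (w * s + (1 - w) * t).
    by apply: ccQ => //; rewrite !set_itvE /=; lra.
  have rF : w * s + (1 - w) * t <= F z.
    have : w * s + (1 - w) * t <= w * (F x + e) + (1 - w) * (F y + e) by nra.
    rewrite /e; lra.
  have := quantile_le mu z r01; rewrite rF => /idP; nra.
apply: concave_function_ordered => x y w.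
rewrite !set_itvE /= ?andbT => nux nuy xy w01; case/andP: (w01) => w0 w1.
set z := w * x + (1 - w) * y.
have xz : x < z by rewrite /z; nra.
have zy : z < y by rewrite /z; nra.
(* Here [x] may equal [nu]; moving from [z] to [z'] gives room to use [above] at [x + d], beyond
   [nu]. *)
apply: distr_fun_right_continuous => z' zz'.
rewrite leNgt; apply/negP => Flt.
have Fz1 : F z' < 1.
  apply: (lt_le_trans Flt).
  by have := distr_fun_le1 mu x; have := distr_fun_le1 mu y; nra.
pose d := z' - z.
pose e := (w * F x + (1 - w) * F y - F z') / 2.
have e0 : 0 < e by rewrite /e; lra.
have xd1 : F (x + d) < 1.
  by apply: le_lt_trans Fz1; apply: distr_fun_nondecreasing; rewrite /d; lra.
have [s [s01 as_ sF]] := above (x + d) ltac:(rewrite /d; lra) xd1.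
have level u : x <= u ->
    exists t, [/\ 0 < t < 1, alpha <= t, F u - e <= t & Q t <= u + d].
  move=> xu; exists (Num.max s (F u - e)).
  have Fu1 := distr_fun_le1 mu u.
  case/andP: s01 => s0 s1.
  have t01 : 0 < Num.max s (F u - e) < 1 by rewrite lt_max gt_max s0 s1; lra.
  split=> //.
  - by rewrite le_max as_.
  - by rewrite le_max lexx orbT.
  - rewrite quantile_le// ge_max (le_trans sF) ?distr_fun_nondecreasing//;
      last by rewrite lerD2r.
    apply: (@le_trans _ _ (F u)); first lra.
    by rewrite distr_fun_nondecreasing// /d; lra.
have [t1 [t101 at1 Ft1 Qt1]] := level x (lexx x).
have [t2 [t201 at2 Ft2 Qt2]] := level y (ltW xy).
have r01 : 0 < w * t1 + (1 - w) * t2 < 1 by apply/andP; split; nra.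
have : Q (w * t1 + (1 - w) * t2) <= z'.
  apply: (@le_trans _ _ (w * Q t1 + (1 - w) * Q t2)).
    by apply: cvQ => //; rewrite !set_itvE /=; lra.
  have : w * Q t1 + (1 - w) * Q t2 <= w * (x + d) + (1 - w) * (y + d) by nra.
  have -> : w * (x + d) + (1 - w) * (y + d) = z + d by rewrite /z; ring.
  rewrite /d; lra.
rewrite quantile_le//.
have : w * t1 + (1 - w) * t2 >= w * (F x - e) + (1 - w) * (F y - e) by nra.
rewrite /e; lra.
Qed.

End QuantileToCdf.

(** * Integrals over intervals, determined by bounds on small pieces *)

Section IntervalIntegrals.
Variable R : realType.
Implicit Types (q : R -> \bar R) (G g : R -> R) (a b c : R).
Local Notation leb := (@lebesgue_measure R).

Lemma integral_cst_itvoo a b c : a <= b ->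
  (\int[leb]_(u in `]a, b[) (c%:E) = (c * (b - a))%:E)%E.
Proof.
move=> ab; rewrite integral_cst//= lebesgue_measure_itv /=.
case: ifPn; rewrite lte_fin => ab'; first by rewrite -EFinB -EFinM.
have -> : b = a by lra.
by rewrite subrr mulr0 mule0.
Qed.

(** Endpoints are null, so the bound is asked only inside; this allows a density whose value at
    [alpha] belongs to the other branch. *)
Lemma integral_itv_ge q a b c : a <= b -> 0 <= c ->
  measurable_fun `[a, b] q -> (forall u, a < u < b -> (c%:E <= q u)%E) ->
  ((c * (b - a))%:E <= \int[leb]_(u in `[a, b]) q u)%E.
Proof.
move=> ab c0 mq cq.
have mq' : measurable_fun `]a, b[ q.
  by apply: measurable_funS mq => //; exact: subset_itvW.
rewrite integral_itv_bndoo// -integral_cst_itvoo//.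
apply: ge0_le_integral => //.
Qed.

Lemma integral_itv_le q a b c : a <= b ->
  measurable_fun `[a, b] q ->
  (forall u, a < u < b -> (0 <= q u <= c%:E)%E) ->
  (\int[leb]_(u in `[a, b]) q u <= (c * (b - a))%:E)%E.
Proof.
move=> ab mq cq.
have mq' : measurable_fun `]a, b[ q.
  by apply: measurable_funS mq => //; exact: subset_itvW.
rewrite integral_itv_bndoo// -integral_cst_itvoo//.
by apply: ge0_le_integral => // u /=; rewrite in_itv => /cq /andP[].
Qed.

Lemma integral_itv_split q a b c : a <= b -> b <= c ->
  measurable_fun `[a, c] q -> (forall u, a <= u <= c -> (0 <= q u)%E) ->
  (\int[leb]_(u in `[a, c]) q u =
   \int[leb]_(u in `[a, b]) q u + \int[leb]_(u in `[b, c]) q u)%E.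
Proof.
move=> ab bc mq q0.
have acE : `[a, c]%classic = `[a, b] `|` `]b, c] :> set R.
  by rewrite -itv_bndbnd_setU// bnd_simp.
rewrite acE ge0_integral_setU//.
- rewrite integral_itv_obnd_cbnd//; apply: measurable_funS mq => //.
  by apply: subset_itvr; rewrite bnd_simp.
- by rewrite -acE.
- by rewrite -acE => u /=; rewrite in_itv; exact: q0.
- apply/disj_setPS => u /= [].
  by rewrite !in_itv /= => /andP[_ ub] /andP[]; rewrite ltNge ub.
Qed.

(* Cutting [a, b] into n pieces improves the bound by a factor n. *)
Lemma additive_interval_function_eq0 (D : R -> R -> R) g a b : a <= b ->
  (forall x y z, a <= x -> x <= y -> y <= z -> z <= b ->
     D x z = D x y + D y z) ->
  (forall x y, a <= x -> x <= y -> y <= b ->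
     `|D x y| <= (g y - g x) * (y - x)) ->
  D a b = 0.
Proof.
move=> ab addD leD.
have Dn n : `|D a b| * n.+1%:R <= (g b - g a) * (b - a).
  have n0 : (0 : R) < n.+1%:R by rewrite ltr0n.
  pose h := (b - a) / n.+1%:R.
  have h0 : 0 <= h by rewrite divr_ge0 ?subr_ge0// ltW.
  have hE : a + n.+1%:R * h = b by rewrite /h mulrC divfK ?gt_eqF// subrKC.
  (* All pieces have length [h], so the bounds telescope in [g]. *)
  have step k : (k <= n.+1)%N ->
      `|D a (a + k%:R * h)| <= (g (a + k%:R * h) - g a) * h.
    elim: k => [_|k IHk kn].
      by rewrite mul0r addr0 (le_trans (leD _ _ _ _ _))// !subrr !mul0r.
    have khb : a + k.+1%:R * h <= b.
      by rewrite -hE lerD2l ler_wpM2r// ler_nat.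
    have kh : a + k%:R * h <= a + k.+1%:R * h.
      by rewrite lerD2l ler_wpM2r// ler_nat.
    have akh : a <= a + k%:R * h by rewrite lerDl mulr_ge0.
    rewrite (addD _ (a + k%:R * h))//.
    apply: (le_trans (ler_normD _ _)).
    have := leD _ _ akh kh khb; have := IHk (ltnW kn).
    have -> : a + k.+1%:R * h - (a + k%:R * h) = h by rewrite -natr1; ring.
    lra.
  have := step _ (leqnn _).
  rewrite hE => /(ler_wpM2r (ltW n0)) /le_trans; apply.
  by rewrite -mulrA /h divfK ?gt_eqF.
apply/eqP; rewrite -normr_le0 leNgt; apply/negP => D0.
set K := (g b - g a) * (b - a) in Dn.
have : K / `|D a b| < (Num.truncn (K / `|D a b|)).+1%:R by exact: truncnS_gt.
by rewrite ltr_pdivrMr// mulrC ltNge Dn.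
Qed.

(* Meant for [g = q], or [g = - q] when [q] is nonincreasing, with [lo] and [hi]
   the endpoint values of [q]. *)
Lemma integral_itv_slopes q G g a b : a <= b ->
  measurable_fun `[a, b] q -> (forall u, a <= u <= b -> (0 <= q u)%E) ->
  (forall x y, a <= x -> x <= y -> y <= b ->
     exists lo hi : R, [/\ 0 <= lo, hi - lo = g y - g x,
       forall u, x < u < y -> (lo%:E <= q u <= hi%:E)%E &
       lo * (y - x) <= G y - G x <= hi * (y - x)]) ->
  (\int[leb]_(u in `[a, b]) q u = (G b - G a)%:E)%E.
Proof.
move=> ab mq q0 slopes.
have mqs x y : a <= x -> y <= b -> measurable_fun `[x, y] q.
  move=> ax yb; apply: measurable_funS mq => //.
  by apply: subset_itv; rewrite bnd_simp.
pose I x y := (\int[leb]_(u in `[x, y]) q u)%E.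
have Ibnd x y : a <= x -> x <= y -> y <= b -> exists lo hi,
    [/\ hi - lo = g y - g x, ((lo * (y - x))%:E <= I x y)%E,
      (I x y <= (hi * (y - x))%:E)%E &
       lo * (y - x) <= G y - G x <= hi * (y - x)].
  move=> ax xy yb; have [lo [hi [lo0 lohi qlh Glh]]] := slopes _ _ ax xy yb.
  exists lo, hi; split=> //.
    by apply: integral_itv_ge => //; [exact: mqs | move=> u /qlh /andP[]].
  apply: integral_itv_le => //; first exact: mqs.
  move=> u uxy; case/andP: (qlh u uxy) => _ ->.
  by rewrite q0//; lra.
have Ifin x y : a <= x -> x <= y -> y <= b -> I x y \is a fin_num.
  move=> ax xy yb; have [lo [hi [_ Ilo Ihi _]]] := Ibnd _ _ ax xy yb.
  by rewrite fin_numElt (lt_le_trans _ Ilo) ?ltNyr// (le_lt_trans Ihi) ?ltry.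
rewrite -/(I a b) -(fineK (Ifin _ _ _ _ _))//; congr (_%:E).
apply/eqP; rewrite -subr_eq0; apply/eqP.
(* The defect is additive over adjacent intervals, and both of its terms lie between [lo * (y - x)]
   and [hi * (y - x)]. *)
pose D x y := fine (I x y) - (G y - G x).
apply: (@additive_interval_function_eq0 D g) => //; rewrite /D.
  move=> x y z ax xy yz zb.
  have ->: fine (I x z) = fine (I x y) + fine (I y z).
    rewrite -fineD ?Ifin//; try lra.
    rewrite {1}/I (integral_itv_split xy yz)//; first exact: mqs.
    by move=> u ?; apply: q0; lra.
  ring.
move=> x y ax xy yb; have [lo [hi [lohi Ilo Ihi Glh]]] := Ibnd _ _ ax xy yb.
rewrite -(fineK (Ifin _ _ ax xy yb)) !lee_fin in Ilo Ihi.
rewrite -lohi ler_norml; lra.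
Qed.

End IntervalIntegrals.

(** * Quasi-convex functions: measurability and monotone branches *)

Section QuasiConvexFunctions.
Variable R : realType.
Implicit Types (q : R -> \bar R) (a b : R).

Lemma quasi_convex_between a b q x y z : quasi_convex `]a, b[ q ->
  a < x -> x <= y -> y <= z -> z < b -> (q y <= Order.max (q x) (q z))%E.
Proof.
move=> qq ax xy yz zb.
have [xy'|] := ltP x y; last first.
  by move=> yx; (have -> : y = x by lra); rewrite le_max lexx.
have [yz'|] := ltP y z; last first.
  by move=> zy; (have -> : y = z by lra); rewrite le_max lexx orbT.
pose w := (z - y) / (z - x).
have w01 : 0 < w < 1 by rewrite divr_gt0 ?ltr_pdivrMr; lra.
have -> : y = w * x + (1 - w) * z by rewrite /w; field; lra.
by apply: qq; rewrite //= in_itv /=; lra.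
Qed.

(** Strict sublevel sets of a quasi-convex function are intervals. *)
Lemma quasi_convex_measurable a b (g : R -> R) :
  quasi_convex `]a, b[ (EFin \o g) -> measurable_fun `]a, b[ g.
Proof.
move=> qg; apply: (measurability (@RGenInftyO.G R)) => [|/= _ [_] [r] -> <-].
  exact: RGenInftyO.measurableE.
apply: is_interval_measurable => s t /=.
rewrite !in_itv /= => -[sab gs] [tab gt] u /andP[su ut].
rewrite /= !in_itv /=; split; first by lra.
have [sa tb] : a < s /\ t < b by lra.
have := quasi_convex_between qg sa su ut tb.
by rewrite /= -EFin_max lee_fin => /le_lt_trans; apply; rewrite gt_max gs.
Qed.

(* [alpha] is the supremum of the points from which [q] still decreases
   somewhere further right. *)
Lemma quasi_convex_valley a b q : a <= b -> quasi_convex `]a, b[ q ->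
  exists alpha, [/\ a <= alpha <= b,
    forall x y, a < x -> x <= y -> y < alpha -> (q y <= q x)%E &
    forall x y, alpha < x -> x <= y -> y < b -> (q x <= q y)%E].
Proof.
move=> ab qq.
(* The point [a] makes [S] nonempty even if [q] never decreases. *)
pose S := [set s | s = a \/ exists t, [/\ a < s, s < t, t < b & (q t < q s)%E]].
have Sb : ubound S b by move=> s /= [->//|[t [_ st tb _]]]; lra.
have hS : has_sup S by split; [exists a; left | exists b].
have aS : a <= sup S by apply: ub_le_sup; [exists b | left].
exists (sup S); split.
- by rewrite aS ge_sup//; exists a; left.
- move=> x y ax xy yS.
  have e0 : 0 < sup S - y by lra.
  (* Beyond [y], [q] drops from [s] to [t]. Hence [q y >= q s > q t], and the maximum of [q x] and
     [q t] that bounds [q y] must be [q x]. *)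
  have [s Ss] := sup_adherent e0 hS; rewrite subKr => ys.
  case: Ss => [sa|[t [as_ st tb qts]]]; first by exfalso; lra.
  have qsy : (q s <= q y)%E.
    have : (q s <= Order.max (q y) (q t))%E.
      by apply: (quasi_convex_between qq); lra.
    by rewrite le_max => /orP[//|]; rewrite leNgt qts.
  have : (q y <= Order.max (q x) (q t))%E.
    by apply: (quasi_convex_between qq); lra.
  rewrite le_max => /orP[//|qyt].
  by have := le_lt_trans qsy (le_lt_trans qyt qts); rewrite ltxx.
- move=> x y Sx xy yb; rewrite leNgt; apply/negP => qyx.
  have [xy'|yx] := ltP x y; last first.
    have yxE : y = x by lra.
    by move: qyx; rewrite yxE ltxx.
  have : x <= sup S.
    by apply: ub_le_sup; [exists b | right; exists y; split=> //; lra].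
  lra.
Qed.

End QuasiConvexFunctions.

(** * One-sided derivatives as bounds on increments *)

Section Slopes.
Variable R : realType.
Implicit Types (D : set R) (G g : R -> R).

(* The witness is the right derivative. *)
Lemma convex_nondecreasing_slopes D G b :
  (forall x, D x -> x < b) -> (forall x y, D x -> x <= y -> y < b -> D y) ->
  (forall x y, D x -> D y -> x <= y -> G x <= G y) -> convex_function D G ->
  exists g, (forall x, D x -> 0 <= g x) /\
    forall x y, D x -> D y -> x <= y ->
      g x * (y - x) <= G y - G x <= g y * (y - x).
Proof.
move=> Db Dup Gnd /convex_function_slopeP cG.
pose S x := [set s | exists z, [/\ x < z, z < b & s = (G z - G x) / (z - x)]].
have S0 x : D x -> lbound (S x) 0.
  move=> Dx _ [z [xz zb ->]].
  have Dz : D z := Dup _ _ Dx (ltW xz) zb.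
  by rewrite divr_ge0 ?subr_ge0 ?Gnd// ltW.
have Sne x : D x -> S x !=set0.
  move=> /Db xb; exists ((G ((x + b) / 2) - G x) / ((x + b) / 2 - x)).
  by exists ((x + b) / 2); split=> //; lra.
exists (fun x => inf (S x)); split=> [x Dx|x y Dx Dy].
  by apply: lb_le_inf; [exact: Sne | exact: S0].
rewrite le_eqVlt => /predU1P[<-|xy]; first by rewrite !subrr !mulr0 lexx.
have xy0 : 0 < y - x by rewrite subr_gt0.
apply/andP; split.
  rewrite -ler_pdivlMr//; apply: ge_inf; first by exists 0; exact: S0.
  by exists y; split=> //; exact: Db.
rewrite -ler_pdivrMr//; apply: lb_le_inf; first exact: Sne.
move=> _ [z [yz zb ->]].
have Dz : D z := Dup _ _ Dy (ltW yz) zb.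
rewrite ler_pdivrMr// mulrAC ler_pdivlMr ?subr_gt0//.
by apply: cG => //; rewrite xy.
Qed.

(** The point reflection [x -> - G (- x)] makes [G] convex and keeps it nondecreasing; its right
    derivative at [- x] is the left derivative of [G] at [x]. *)
Lemma concave_nondecreasing_slopes D G a :
  (forall x, D x -> a < x) -> (forall x y, D y -> a < x -> x <= y -> D x) ->
  (forall x y, D x -> D y -> x <= y -> G x <= G y) -> concave_function D G ->
  exists g, (forall x, D x -> 0 <= g x) /\
    forall x y, D x -> D y -> x <= y ->
      g y * (y - x) <= G y - G x <= g x * (y - x).
Proof.
move=> Da Ddown Gnd /concave_function_slopeP cG.
have [||||g [g0 gG]] := @convex_nondecreasing_slopes
    [set x | D (- x)] (fun x => - G (- x)) (- a).
- by move=> x /= /Da; lra.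
- by move=> x y /= Dx xy ya; apply: (Ddown _ _ Dx); lra.
- by move=> x y /= Dx Dy xy; rewrite lerN2 Gnd// lerN2.
- apply/convex_function_slopeP => x y z /= Dx Dz xyz.
  by have := cG (- z) (- y) (- x) Dz Dx; lra.
exists (g \o -%R); split=> [x Dx|x y Dx Dy xy] /=.
  by apply: g0; rewrite /= opprK.
have := gG (- y) (- x); rewrite /= !opprK => /(_ Dy Dx); lra.
Qed.

End Slopes.

(** * A quasi-convex density from a quantile mode *)

Section QuantileDensity.
Variables (R : realType) (mu : probability (measurableTypeR R) R).
Local Notation Q := (quantile mu).

Lemma quantile_mode_density alpha : quantile_mode mu alpha ->
  exists q, quantile_density mu q /\ quasi_convex `]0, 1[ q.
Proof.
move=> [/andP[a0 a1] [ccQ cvQ]].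
have [|||gl [gl0 glQ]] := concave_nondecreasing_slopes _ _ _ ccQ (a := 0).
- by move=> x [_]; rewrite /= in_itv /= => /andP[].
- by move=> x y; rewrite /= !in_itv /=; lra.
- move=> x y [_ +] [_]; rewrite /= !in_itv /=; exact: quantile_nondecreasing.
have [|||gr [gr0 grQ]] := convex_nondecreasing_slopes _ _ _ cvQ (b := 1).
- by move=> x [_]; rewrite /= in_itv /= => /andP[].
- by move=> x y; rewrite /= !in_itv /=; lra.
- move=> x y [_ +] [_]; rewrite /= !in_itv /=; exact: quantile_nondecreasing.
have {}gl0 (x : R) : 0 < x < 1 -> x <= alpha -> 0 <= gl x.
  by move=> x01 xa; apply: gl0; rewrite /= !in_itv /=; lra.
have {}gr0 (x : R) : 0 < x < 1 -> alpha <= x -> 0 <= gr x.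
  by move=> x01 xa; apply: gr0; rewrite /= !in_itv /=; lra.
have {}glQ (x y : R) : 0 < x -> x <= y -> y < 1 -> y <= alpha ->
    gl y * (y - x) <= Q y - Q x <= gl x * (y - x).
  by move=> *; apply: glQ; rewrite /= ?in_itv /=; lra.
have {}grQ (x y : R) : 0 < x -> x <= y -> y < 1 -> alpha <= x ->
    gr x * (y - x) <= Q y - Q x <= gr y * (y - x).
  by move=> *; apply: grQ; rewrite /= ?in_itv /=; lra.
have gl_ni (x y : R) : 0 < x -> x <= y -> y < 1 -> y <= alpha -> gl y <= gl x.
  move=> x0; rewrite le_eqVlt => /predU1P[->//|xy] y1 ya.
  by have := glQ x y x0 (ltW xy) y1 ya; nra.
have gr_nd (x y : R) : 0 < x -> x <= y -> y < 1 -> alpha <= x -> gr x <= gr y.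
  move=> x0; rewrite le_eqVlt => /predU1P[->//|xy] y1 ya.
  by have := grQ x y x0 (ltW xy) y1 ya; nra.
(* At [alpha] itself the left branch is taken; on intervals starting at [alpha] only interior values
   are compared with [gr]. *)
pose q x := if x <= alpha then gl x else gr x.
have q0 (x : R) : 0 < x < 1 -> 0 <= q x.
  move=> x01; rewrite /q; case: (leP x alpha) => xa; first exact: gl0.
  by apply: gr0; rewrite ?ltW.
have qc : quasi_convex `]0, 1[ (EFin \o q).
  have ordered (x y z : R) : 0 < x -> x <= z <= y -> y < 1 ->
      q z <= Num.max (q x) (q y).
    move=> x0 /andP[xz zy] y1; rewrite le_max /q.
    have [za|az] := leP z alpha.
      by rewrite (le_trans xz za) gl_ni//; lra.
    by rewrite (leNgt y) (lt_le_trans az zy) /= gr_nd ?orbT//; lra.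
  move=> x y w; rewrite /= !in_itv /= => x01 y01 w01; rewrite -EFin_max lee_fin.
  case/andP: w01 => w0 w1.
  have [xy|yx] := leP x y.
    apply: ordered; [lra | | lra].
    by apply/andP; split; nra.
  rewrite maxC; apply: ordered; [lra | | lra].
  by apply/andP; split; nra.
have mq : measurable_fun (`]0, 1[ : set R) (EFin \o q).
  by apply/measurable_EFinP; exact: (quasi_convex_measurable qc).
have mqs (x y : R) : 0 < x -> y < 1 -> measurable_fun `[x, y] (EFin \o q).
  move=> x0 y1; apply: measurable_funS mq => //.
  by apply: subset_itv; rewrite bnd_simp.
have intl (x y : R) : 0 < x -> x <= y -> y < 1 -> y <= alpha ->
    (\int[@lebesgue_measure R]_(u in `[x, y]) (q u)%:E = (Q y - Q x)%:E)%E.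
  move=> x0 xy y1 ya.
  apply: (@integral_itv_slopes _ _ _ (fun u => - gl u)) => //.
  - exact: mqs.
  - by move=> u xuy; rewrite lee_fin q0//; lra.
  move=> s t xs st ty; exists (gl t), (gl s); split.
  - by apply: gl0; lra.
  - by ring.
  - move=> u /andP[su ut]; rewrite !lee_fin /q.
    have -> : u <= alpha by lra.
    by rewrite !gl_ni//; lra.
  - by apply: glQ; lra.
have intr (x y : R) : 0 < x -> x <= y -> y < 1 -> alpha <= x ->
    (\int[@lebesgue_measure R]_(u in `[x, y]) (q u)%:E = (Q y - Q x)%:E)%E.
  move=> x0 xy y1 ya.
  apply: (@integral_itv_slopes _ _ _ gr) => //.
  - exact: mqs.
  - by move=> u xuy; rewrite lee_fin q0//; lra.
  move=> s t xs st ty; exists (gr s), (gr t); split.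
  - by apply: gr0; lra.
  - by [].
  - move=> u /andP[su ut]; rewrite !lee_fin /q.
    have /lt_geF -> : alpha < u by lra.
    by rewrite !gr_nd//; lra.
  - by apply: grQ; lra.
have intq (x y : R) : 0 < x -> x <= y -> y < 1 ->
    (\int[@lebesgue_measure R]_(u in `[x, y]) (q u)%:E = (Q y - Q x)%:E)%E.
  move=> x0 xy y1; have [ya|ay] := leP y alpha; first exact: intl.
  have [ax|xa] := leP alpha x; first exact: intr.
  apply: (etrans (integral_itv_split (q := EFin \o q) (ltW xa) (ltW ay) _ _)).
  - exact: mqs.
  - by move=> u xuy; rewrite lee_fin q0//; lra.
  have alpha0 : 0 < alpha by lra.
  have alpha1 : alpha < 1 by lra.
  rewrite intl ?intr ?(ltW xa) ?(ltW ay)//.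
  by rewrite -EFinD; congr (_%:E); ring.
exists (EFin \o q); split=> //; split=> // x y x01 y01.
rewrite /oriented_integral; case: (leP x y) => xy.
  by rewrite intq//; [case/andP: x01 | case/andP: y01].
rewrite intq ?(ltW xy)//; [|by case/andP: y01|by case/andP: x01].
by rewrite -EFinN opprB.
Qed.

End QuantileDensity.

(** * A quantile mode from a quasi-convex density *)

Section DensityToMode.
Variables (R : realType) (mu : probability (measurableTypeR R) R).
Local Notation Q := (quantile mu).

Lemma quantile_density_ge q x y c : quantile_density mu q ->
  0 < x -> x <= y -> y < 1 -> 0 <= c ->
  (forall u, x < u < y -> (c%:E <= q u)%E) -> c * (y - x) <= Q y - Q x.
Proof.
move=> [mq q0 qQ] x0 xy y1 c0 cq.
rewrite -lee_fin qQ; [|lra|lra].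
rewrite /oriented_integral xy; apply: integral_itv_ge => //.
by apply: measurable_funS mq => //; apply: subset_itv; rewrite bnd_simp.
Qed.

Lemma quantile_density_le q x y c : quantile_density mu q ->
  0 < x -> x <= y -> y < 1 ->
  (forall u, x < u < y -> (q u <= c%:E)%E) -> Q y - Q x <= c * (y - x).
Proof.
move=> [mq q0 qQ] x0 xy y1 cq.
rewrite -lee_fin qQ; [|lra|lra].
rewrite /oriented_integral xy; apply: integral_itv_le => //.
  by apply: measurable_funS mq => //; apply: subset_itv; rewrite bnd_simp.
by move=> u uxy; rewrite cq// q0//; lra.
Qed.

(** An infinite density would dominate every constant; [c] is chosen to make the increment of [Q] at
    least [Q y - Q x + 1]. *)
Lemma quantile_density_lty q x y : quantile_density mu q ->
  0 < x -> x < y -> y < 1 -> ~ forall u, x < u < y -> q u = +oo%E.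
Proof.
move=> qd x0 xy y1 qy.
have Qxy : Q x <= Q y by apply: quantile_nondecreasing; lra.
pose c := (Q y - Q x + 1) / (y - x).
have c0 : 0 <= c by rewrite divr_ge0; lra.
have := quantile_density_ge qd x0 (ltW xy) y1 c0.
rewrite divfK; last by rewrite subr_eq0 gt_eqF.
have cq u : x < u < y -> (c%:E <= q u)%E by move=> /qy ->; rewrite leey.
by move=> /(_ cq); lra.
Qed.

(** The middle point [y] lies strictly on one side of [alpha], and so do the interior points
    compared with it, so [q alpha] never enters. *)
Lemma quasi_convex_density_mode q :
  quantile_density mu q -> quasi_convex `]0, 1[ q ->
  exists alpha, quantile_mode mu alpha.
Proof.
move=> qd qq; have [_ q0 _] := qd.
have [alpha [a01 qni qnd]] := quasi_convex_valley ler01 qq.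
exists alpha; split=> //; split.
- apply/concave_function_slopeP => x y z.
  rewrite /= !in_itv /= => -[_ x01] [za z01] /andP[xy yz].
  have y01 : 0 < y < 1 by lra.
  (* If [q y] were infinite, monotonicity would make [q] infinite on all of (x, y). *)
  have := q0 y y01; case qyE : (q y) => [r| |] //; last first.
    move=> _; exfalso; apply: (@quantile_density_lty q x y qd); try lra.
    move=> u /andP[xu uy]; apply/eqP; rewrite -leye_eq -qyE; apply: qni; lra.
  rewrite lee_fin => r0.
  have : r * (y - x) <= Q y - Q x.
    apply: (quantile_density_ge qd); try lra.
    by move=> u /andP[xu uy]; rewrite -qyE; apply: qni; lra.
  have : Q z - Q y <= r * (z - y).
    apply: (quantile_density_le qd); try lra.
    by move=> u /andP[yu uz]; rewrite -qyE; apply: qni; lra.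
  nra.
- apply/convex_function_slopeP => x y z.
  rewrite /= !in_itv /= => -[xa x01] [_ z01] /andP[xy yz].
  have y01 : 0 < y < 1 by lra.
  have := q0 y y01; case qyE : (q y) => [r| |] //; last first.
    move=> _; exfalso; apply: (@quantile_density_lty q y z qd); try lra.
    move=> u /andP[yu uz]; apply/eqP; rewrite -leye_eq -qyE; apply: qnd; lra.
  rewrite lee_fin => r0.
  have : r * (z - y) <= Q z - Q y.
    apply: (quantile_density_ge qd); try lra.
    by move=> u /andP[yu uz]; rewrite -qyE; apply: qnd; lra.
  have : Q y - Q x <= r * (y - x).
    apply: (quantile_density_le qd); try lra.
    by move=> u /andP[xu uy]; rewrite -qyE; apply: qnd; lra.
  nra.
Qed.

End DensityToMode.

Theorem theorem1p6 (R : realType) (mu : probability (measurableTypeR R) R) :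
  [<-> cdf_unimodal mu;
       exists q : R -> \bar R, quantile_density mu q /\ quasi_convex `]0, 1[ q;
       exists alpha : R, quantile_mode mu alpha].
Proof.
tfae.
(* The first implication passes through (b). *)
- by move=> /cdf_unimodal_quantile_mode[alpha /quantile_mode_density].
- by move=> [q [qd qq]]; exact: quasi_convex_density_mode qd qq.
- by move=> [alpha]; exact: quantile_mode_cdf_unimodal.
Qed.
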